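(* Let $\mathcal V$ be a congruence distributive variety. Then the alvin level of $\mathcal V$ equals the Gumm level of $\mathcal V$; that is, the minimal natural number $n \geq 0$ such that $\mathcal V$ has a sequence $t_0,\dots,t_n$ of alvin terms is equal to the minimal natural number $n\ge 0$ such that $\mathcal V$ has a sequence $t_0,\dots,t_n$ of Gumm terms.
   Context: A variety is a class of algebras of the same type definable by a set of equations; it is congruence distributive if the congruence lattice of each of its members is distributive. A sequence $t_0,\dots,t_n$ of ternary terms is a sequence of alvin terms for a variety $\mathcal V$ if the following equations hold in all algebras of $\mathcal V$: (A1) $x=t_h(x,y,x)$ for $0<h<n$; (A2) $x=t_0(x,y,z)$; (A3) $t_h(x,z,z)=t_{h+1}(x,z,z)$ for $h$ even, $0\le h<n$; (A4) $t_h(x,x,z)=t_{h+1}(x,x,z)$ for $h$ odd, $0\le h<n$; (A5) $t_n(x,y,z)=z$. A sequence $t_0,\dots,t_n$ is a sequence of Gumm terms for $\mathcal V$ if it satisfies (A2)--(A5) and (G1) $x=t_h(x,y,x)$ for $1<h<n$ (that is, all of (A1)--(A5) except possibly $x=t_1(x,y,x)$). The cases $n=0$ and $n=1$ are allowed (they force the variety to be trivial). It is a known theorem that a variety is congruence distributive if and only if it has a sequence of alvin terms for some $n$; and that a variety is congruence modular if and only if it has a sequence of Gumm terms for some $n$. Hence both levels are defined for a congruence distributive variety. *)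

(* Defs.v *)
From Corelib Require RelationClasses.
From mathcomp Require Import all_boot.

Set Implicit Arguments.
Unset Strict Implicit.
Unset Printing Implicit Defensive.

(* A type of algebras: arbitrarily many operation symbols, each finitary. *)
Record signature := Signature {
  symbol : Type;
  arity : symbol -> nat
}.

Record algebra (S : signature) := Algebra {
  carrier :> Type;
  carrier_nonempty : inhabited carrier;
  interp : forall f : symbol S, ('I_(arity f) -> carrier) -> carrier
}.

Inductive term (S : signature) (X : Type) : Type :=
| Var of X
| App (f : symbol S) of ('I_(arity f) -> term S X).

Arguments Var {S X} _.
Arguments App {S X} _ _.

Fixpoint eval (S : signature) (X : Type) (A : algebra S) (v : X -> A)
    (t : term S X) : A :=
  match t with
  | Var x => v x
  | App f ts => interp (fun i => eval v (ts i))
  end.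

Definition satisfies (S : signature) (A : algebra S)
    (E : term S nat -> term S nat -> Prop) : Prop :=
  forall s t, E s t -> forall v : nat -> A, eval v s = eval v t.

Definition is_variety (S : signature) (V : algebra S -> Prop) : Prop :=
  exists E : term S nat -> term S nat -> Prop,
    forall A : algebra S, V A <-> satisfies A E.

Definition compatible (S : signature) (A : algebra S) (R : A -> A -> Prop) :=
  forall (f : symbol S) (a b : 'I_(arity f) -> A),
    (forall i, R (a i) (b i)) -> R (interp a) (interp b).

Record congruence (S : signature) (A : algebra S) := Congruence {
  con_rel :> A -> A -> Prop;
  con_equiv : RelationClasses.Equivalence con_rel;
  con_compat : compatible con_rel
}.

Section CongruenceLattice.

Variables (S : signature) (A : algebra S).
Implicit Types a b c : congruence A.

Definition con_le a b : Prop := forall x y, a x y -> b x y.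

Definition con_eq a b : Prop := forall x y, a x y <-> b x y.

Definition meet_rel a b (x y : A) : Prop := a x y /\ b x y.

Fact meet_equiv a b : RelationClasses.Equivalence (meet_rel a b).
Proof.
case: (con_equiv a) (con_equiv b) => ar asym atr [br bsym btr].
split=> [x|x y [h k]|x y z [h k] [h' k']]; split; eauto.
Qed.

Fact meet_compat a b : compatible (meet_rel a b).
Proof.
by move=> f u v h; split; apply: con_compat => i; case: (h i).
Qed.

Definition con_meet a b : congruence A :=
  Congruence (meet_equiv a b) (@meet_compat a b).

Definition join_rel a b (x y : A) : Prop :=
  forall c, con_le a c -> con_le b c -> c x y.

Fact join_equiv a b : RelationClasses.Equivalence (join_rel a b).
Proof.
split=> [x|x y h|x y z h k] c ac bc; case: (con_equiv c) => r s t.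
- exact: r.
- exact: s (h c ac bc).
- exact: t (h c ac bc) (k c ac bc).
Qed.

Fact join_compat a b : compatible (join_rel a b).
Proof.
by move=> f u v h c ac bc; apply: con_compat => i; apply: h.
Qed.

Definition con_join a b : congruence A :=
  Congruence (join_equiv a b) (@join_compat a b).

Fact con_meetP a b c :
  con_le c (con_meet a b) <-> con_le c a /\ con_le c b.
Proof.
split=> [h|[h k] x y cxy]; last by split; [apply: h | apply: k].
by split=> x y /h[].
Qed.

Fact con_joinP a b c :
  con_le (con_join a b) c <-> con_le a c /\ con_le b c.
Proof.
split=> [h|[h k] x y]; last exact.
by split=> x y xy; apply: h => d ad bd; [apply: ad | apply: bd].
Qed.

Definition con_distributive : Prop :=
  forall a b c,
    con_eq (con_meet a (con_join b c))
           (con_join (con_meet a b) (con_meet a c)).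

End CongruenceLattice.

Definition congruence_distributive (S : signature)
    (V : algebra S -> Prop) : Prop :=
  forall A : algebra S, V A -> con_distributive A.

Definition ternary_term (S : signature) := term S 'I_3.

Definition eval3 (S : signature) (A : algebra S) (t : ternary_term S)
    (x y z : A) : A :=
  eval (tnth [tuple x; y; z]) t.

(* In the following definitions a sequence t_0, ..., t_n is a function on nat
   of which only the values at 0, ..., n matter. *)

Definition common_equations (S : signature) (V : algebra S -> Prop) (n : nat)
    (t : nat -> ternary_term S) : Prop :=
  forall A : algebra S, V A ->
  [/\ forall x y z : A, x = eval3 (t 0) x y z,
      forall h, h < n -> ~~ odd h ->
        forall x z : A, eval3 (t h) x z z = eval3 (t h.+1) x z z,
      forall h, h < n -> odd h ->
        forall x z : A, eval3 (t h) x x z = eval3 (t h.+1) x x z &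
      forall x y z : A, eval3 (t n) x y z = z].

Definition alvin_terms (S : signature) (V : algebra S -> Prop) (n : nat)
    (t : nat -> ternary_term S) : Prop :=
  common_equations V n t /\
  forall A : algebra S, V A ->
    forall h, 0 < h < n -> forall x y : A, x = eval3 (t h) x y x.

Definition gumm_terms (S : signature) (V : algebra S -> Prop) (n : nat)
    (t : nat -> ternary_term S) : Prop :=
  common_equations V n t /\
  forall A : algebra S, V A ->
    forall h, 1 < h < n -> forall x y : A, x = eval3 (t h) x y x.

Definition is_least (P : nat -> Prop) (n : nat) : Prop :=
  P n /\ forall m, P m -> n <= m.

Definition alvin_level (S : signature) (V : algebra S -> Prop) (n : nat) :=
  is_least (fun m => exists t, alvin_terms V m t) n.

Definition gumm_level (S : signature) (V : algebra S -> Prop) (n : nat) :=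
  is_least (fun m => exists t, gumm_terms V m t) n.

(* Main.v *)
(** By distributivity applied to the free algebra on [x, y, z], with [alpha],
    [beta], [gamma] generated by [x ~ z], [x ~ y], [y ~ z], the pair [(x, z)]
    lies in the join of [alpha /\ gamma] and [alpha /\ beta]; a chain witnessing
    this is a sequence of alvin terms [j_0, ..., j_k], of uncontrolled length.

    Let [t_0, ..., t_n] be Gumm terms, [2 <= n].  Suppose that terms [r_2, ...,
    r_n] satisfy the alvin equations and that [f] satisfies
    [f(x,z,z) = x = f(x,y,x)] and [f(x,x,z) = r_2(x,x,s(x,z))]; for [s(x,z) = z]
    these are alvin terms [x, f, r_2, ..., r_n].  If [s(x,z) = d(x,s'(x,z))] and
    [e, e'] are terms with [e(x,y,x) = x = e'(x,y,x)] and
    [e(x,x,z) = s(x,z)], [e(x,z,z) = e'(x,z,z)], [e'(x,x,z) = s'(x,z)],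
    then [s] can be replaced by [s'], using
    [r'_h = t_h(r_h(x,d(x,y),d(x,z)), r_h(x,y,d(y,z)), r_h(x,y,z))] and
    [f' = t_1(f, r_2(x,x,e), r_2(x,x,e'))].  Since [j_0 = x] and [j_k = z], one
    gets from [s_0 = x] to [s_k = z] through the products
    [s_i = eps_i o ... o eps_k], where [eps_i(u) = j_i(x,x,u)]. *)
Require Import Defs.
From mathcomp Require Import all_boot.
From mathcomp Require Import boolp.

Set Implicit Arguments.
Unset Strict Implicit.
Unset Printing Implicit Defensive.

(** * Substitution into terms *)

Section Substitution.

Variable S : signature.

Fixpoint bind (X Y : Type) (u : X -> term S Y) (t : term S X) : term S Y :=
  match t with
  | Var x => u x
  | App f ts => App f (fun i => bind u (ts i))
  end.

Lemma eval_bind (X Y : Type) (A : algebra S) (v : Y -> A) (u : X -> term S Y)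
    (t : term S X) :
  eval v (bind u t) = eval (fun x => eval v (u x)) t.
Proof.
elim: t => //= f ts IH; congr interp; exact: funext.
Qed.

Definition tx : ternary_term S := Var (Ordinal (isT : 0 < 3)).
Definition ty : ternary_term S := Var (Ordinal (isT : 1 < 3)).
Definition tz : ternary_term S := Var (Ordinal (isT : 2 < 3)).

Definition comp3 (t a b c : ternary_term S) : ternary_term S :=
  bind (tnth [tuple a; b; c]) t.

Lemma eval3_tx (A : algebra S) (x y z : A) : eval3 tx x y z = x.
Proof. by []. Qed.

Lemma eval3_ty (A : algebra S) (x y z : A) : eval3 ty x y z = y.
Proof. by []. Qed.

Lemma eval3_tz (A : algebra S) (x y z : A) : eval3 tz x y z = z.
Proof. by []. Qed.

Lemma eval3_comp3 (t a b c : ternary_term S) (A : algebra S) (x y z : A) :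
  eval3 (comp3 t a b c) x y z =
  eval3 t (eval3 a x y z) (eval3 b x y z) (eval3 c x y z).
Proof.
rewrite {1}/eval3 eval_bind /eval3; congr eval.
by apply: funext => -[[|[|[|//]]] h].
Qed.

Definition eval3E := (eval3_comp3, eval3_tx, eval3_ty, eval3_tz).

End Substitution.

Arguments tx {S}.
Arguments ty {S}.
Arguments tz {S}.

(** * Joins of congruences as alternating chains *)

Section Zigzag.

Variables (S : signature) (A : algebra S) (a b : congruence A).

(** A chain is an eventually constant infinite sequence, so that finitely many chains combine
    termwise whatever their lengths. *)
Definition zigzag (s t : A) : Prop :=
  exists N (w : nat -> A),
    [/\ w 0 = s, forall h, N <= h -> w h = t &
        forall h, (if odd h then b else a) (w h) (w h.+1)].

Lemma congruence_refl (c : congruence A) x : c x x.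
Proof. by case: (con_equiv c). Qed.

Lemma congruence_sym (c : congruence A) x y : c x y -> c y x.
Proof. by case: (con_equiv c) => _ h _; apply: h. Qed.

Lemma congruence_trans (c : congruence A) x y z : c x y -> c y z -> c x z.
Proof. by case: (con_equiv c) => _ _; apply. Qed.

Lemma zigzag_equiv : RelationClasses.Equivalence zigzag.
Proof.
split=> [s|s t [N [w [w0 wN wS]]]|s t u [N [w [w0 wN wS]]] [M [w' [w'0 w'N w'S]]]].
- by exists 0, (fun=> s); split=> // h; apply: congruence_refl.
(* The length is odd, so reversal preserves the parity of each step. *)
- pose M := N.*2.+1; exists M, (fun h => w (M - h)); split.
  + by rewrite subn0 wN // /M -addnn -addnS leq_addr.
  + by move=> h /eqP ->.
  + move=> h; case: (ltnP h M) => hM; last first.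
      by rewrite (eqP hM) (eqP (leqW hM)); apply: congruence_refl.
    have := wS (M - h.+1); rewrite subnSK // oddB // [odd h.+1]/=.
    rewrite /M /= odd_double /= negbK.
    by case: ifP => _; apply: congruence_sym.
(* The second chain starts at an even index, so its steps keep their parity. *)
- exists (N.*2 + M), (fun h => if h < N.*2 then w h else w' (h - N.*2)); split.
  + by case: N wN => [|N] wN; rewrite ?doubleS //= w'0 -(wN 0) // w0.
  + move=> h le_h; rewrite ltnNge (leq_trans (leq_addr _ _) le_h) /=.
    by rewrite w'N // leq_subRL // (leq_trans (leq_addr _ _) le_h).
  + move=> h; case: (ltngtP h.+1 N.*2) => [lt|lt|eq].
    * exact: wS.
    * rewrite subSn //.
      by have := w'S (h - N.*2); rewrite oddB // odd_double addbF.
    * rewrite eq subnn w'0 -(wN h.+1) //.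
      by rewrite eq -addnn leq_addr.
Qed.

Lemma zigzag_compat : compatible zigzag.
Proof.
move=> f s t /choice[N] /choice[w] wP.
exists (\max_i N i), (fun h => interp (fun i => w i h)); split.
- by congr interp; apply: funext => i; case: (wP i).
- move=> h leh; congr interp; apply: funext => i; case: (wP i) => _ -> //.
  exact: leq_trans (leq_bigmax i) leh.
- by move=> h; apply: con_compat => i; case: (wP i).
Qed.

Lemma con_join_zigzag s t : con_join a b s t -> zigzag s t.
Proof.
move=> /(_ (Congruence zigzag_equiv zigzag_compat)); apply=> x y xy.
- exists 1, (fun h => if h is 0 then x else y); split=> // -[|h] //.
  by case: ifP => _; apply: congruence_refl.
(* A [b]-step needs an odd index, so a trivial [a]-step precedes it. *)
- exists 2, (fun h => if h is h'.+2 then y else x); split=> //.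
    by case=> [|[]].
  case=> [|[|h]] //; first exact: congruence_refl.
  by case: ifP => _; apply: congruence_refl.
Qed.

End Zigzag.

(** * Relatively free algebras *)

Section FreeAlgebra.

Variables (S : signature) (V : algebra S -> Prop) (X : Type).

Definition equal_in (s t : term S X) : Prop :=
  forall A : algebra S, V A -> forall v : X -> A, eval v s = eval v t.

Definition free_carrier : Type :=
  {P : term S X -> Prop | exists t, P = equal_in t}.

Definition free_class (t : term S X) : free_carrier :=
  exist _ (equal_in t) (ex_intro _ t erefl).

Definition free_repr (c : free_carrier) : term S X := sval (cid (svalP c)).

Lemma free_reprK c : free_class (free_repr c) = c.
Proof.
rewrite /free_repr; case: cid => t /=; case: c => P hP /= Pt.
exact/eq_exist/esym.
Qed.

Lemma free_classP s t : free_class s = free_class t <-> equal_in s t.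
Proof.
split=> [/(congr1 sval) /= -> // |st]; apply: eq_exist; apply: funext => u.
by apply: propext; split=> h A VA v; rewrite -h // st.
Qed.

Lemma free_repr_class t : equal_in (free_repr (free_class t)) t.
Proof. by apply/free_classP; rewrite free_reprK. Qed.

Definition free_algebra (x0 : X) : algebra S :=
  @Algebra S free_carrier (inhabits (free_class (Var x0)))
    (fun f a => free_class (App f (fun i => free_repr (a i)))).

Lemma eval_free (x0 : X) (Y : Type) (v : Y -> free_algebra x0) (t : term S Y) :
  eval v t = free_class (bind (fun y => free_repr (v y)) t).
Proof.
elim: t => [y|f ts IH] /=; first by rewrite free_reprK.
apply/free_classP => A VA w /=; congr interp; apply: funext => i.
by rewrite IH; apply: free_repr_class.
Qed.

Lemma free_in_variety (x0 : X) : is_variety V -> V (free_algebra x0).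
Proof.
case=> E VE; apply/VE => s t st v; rewrite !eval_free.
apply/free_classP => A VA w; rewrite !eval_bind.
by have /VE := VA; apply.
Qed.

Variables (x0 : X) (K : forall A : algebra S, (X -> A) -> Prop).

(** When [K] equates two variables, this plays the role of the congruence generated by that pair,
    and it unfolds directly to equations in [V]. *)
Definition agree_on (s t : free_algebra x0) : Prop :=
  forall A : algebra S, V A -> forall v : X -> A, K v ->
    eval v (free_repr s) = eval v (free_repr t).

Lemma agree_on_equiv : RelationClasses.Equivalence agree_on.
Proof.
split=> [s|s t st|s t u st tu] A VA v Kv //; first by rewrite st.
by rewrite st ?tu.
Qed.

Lemma agree_on_compat : compatible agree_on.
Proof.
move=> f s t st A VA v Kv; rewrite !free_repr_class //=.
by congr interp; apply: funext => i; apply: st.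
Qed.

Definition agree_con := Congruence agree_on_equiv agree_on_compat.

End FreeAlgebra.

(** * Alvin terms from congruence distributivity *)

Section Alvin.

Variables (S : signature) (V : algebra S -> Prop).

Lemma alvin_terms_exist :
  is_variety V -> congruence_distributive V ->
  exists n t, @alvin_terms S V n t.
Proof.
pose i0 := Ordinal (isT : 0 < 3); pose i1 := Ordinal (isT : 1 < 3).
pose i2 := Ordinal (isT : 2 < 3).
move=> varV /(_ _ (free_in_variety i0 varV)) cdF.
pose alpha := agree_con V i0 (fun A (v : 'I_3 -> A) => v i0 = v i2).
pose beta := agree_con V i0 (fun A (v : 'I_3 -> A) => v i0 = v i1).
pose gamma := agree_con V i0 (fun A (v : 'I_3 -> A) => v i1 = v i2).
pose g i : free_algebra V i0 := free_class V (Var i).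
have gE i (A : algebra S) (v : 'I_3 -> A) : V A ->
    eval v (free_repr (g i)) = v i.
  by move=> VA; apply: (@free_repr_class S V _ (Var i)).
have : con_meet alpha (con_join gamma beta) (g i0) (g i2).
  split; first by move=> A VA v Kv; rewrite !gE.
  move=> c gc bc; apply: (congruence_trans (y := g i1)).
    by apply: bc => A VA v Kv; rewrite !gE.
  by apply: gc => A VA v Kv; rewrite !gE.
(* As [gamma] comes first in the join, even steps are the ones with [y = z], as in (A3). *)
case/cdF/con_join_zigzag=> N [w [w0 wN wS]].
have wa h : alpha (g i0) (w h).
  elim: h => [|h IH]; first by rewrite w0; apply: congruence_refl.
  apply: congruence_trans IH _.
  by have := wS h; case: ifP => _ [].
exists N, (fun h => free_repr (w h)); split=> A VA.
  split=> [x y z|h hN ev x z|h hN od x z|x y z].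
  - by rewrite w0 /eval3 gE.
  - by have := wS h; rewrite (negPf ev) => -[_]; apply.
  - by have := wS h; rewrite od => -[_]; apply.
  - by rewrite wN // /eval3 gE.
by move=> h hN x y; rewrite /eval3 -(wa h) // gE.
Qed.

Lemma alvin_gumm n t : alvin_terms V n t -> gumm_terms V n t.
Proof.
by case=> eqs A1; split=> // A VA h /andP[h1 hn]; apply: A1; rewrite ?hn ?(ltnW h1).
Qed.

End Alvin.

(** * Links between binary operations *)

Section Links.

Variables (S : signature) (V : algebra S -> Prop).

(* Ternary terms [s] are read here as binary operations [s(x,x,z)]. *)
Definition link (s s' : ternary_term S) : Prop :=
  exists e e' : ternary_term S, forall A : algebra S, V A ->
  [/\ forall x y : A, eval3 e x y x = x /\ eval3 e' x y x = x,
      forall x z : A, eval3 e x x z = eval3 s x x z,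
      forall x z : A, eval3 e x z z = eval3 e' x z z &
      forall x z : A, eval3 e' x x z = eval3 s' x x z].

Definition bin_comp (s r : ternary_term S) : ternary_term S := comp3 s tx tx r.

Lemma link_ext s s' r r' :
  (forall A : algebra S, V A -> forall x z : A,
     eval3 s x x z = eval3 r x x z /\ eval3 s' x x z = eval3 r' x x z) ->
  link s s' -> link r r'.
Proof.
move=> ext [e [e' eP]]; exists e, e' => A VA.
case: (eP A VA) => [i f m l]; split=> // x z.
  by rewrite f (ext _ VA x z).1.
by rewrite l (ext _ VA x z).2.
Qed.

(** In [d(x, e(x,y,y), e(x,y,z))] the middle entry becomes [x] when [y = x] and the last entry when
    [y = z], so the equations of [d] apply. *)
Lemma link_comp s s' r r' :
  link s s' -> link r r' -> link (bin_comp s r) (bin_comp s' r').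
Proof.
move=> [d [d' dP]] [e [e' eP]].
exists (comp3 d tx (comp3 e tx ty ty) e), (comp3 d' tx (comp3 e' tx ty ty) e').
move=> A VA; case: (dP A VA) => di df dm dl; case: (eP A VA) => ei ef em el.
split=> x y; rewrite !eval3E.
- by rewrite (ei x y).1 (ei x y).2 (di x _).1 (di x _).2.
- by rewrite (ei x x).1 df ef.
- by rewrite em dm.
- by rewrite (ei x x).2 dl el.
Qed.

Fixpoint iter_comp (eps : nat -> ternary_term S) (m : nat) : ternary_term S :=
  if m is m'.+1 then bin_comp (eps m) (iter_comp eps m') else tz.

(* Links act on both sides of a composition, so all factors of the product
   can be shifted simultaneously. *)
Lemma link_iter_comp eps k :
  (forall A : algebra S, V A -> forall x z : A, eval3 (eps 0) x x z = z) ->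
  (forall m, m < k -> link (eps m.+1) (eps m)) ->
  forall m, m < k -> link (iter_comp eps m.+1) (iter_comp eps m).
Proof.
move=> eps0 linkS; elim=> [|m IH] mk; last first.
  exact: link_comp (linkS _ mk) (IH (ltnW mk)).
apply: link_ext (linkS _ mk) => A VA x z.
by rewrite /= /bin_comp !eval3E eps0.
Qed.

Lemma alvin_link n t h : alvin_terms V n t -> h < n -> link (t h) (t h.+1).
Proof.
move=> [eqs A1] hn.
have idem k : k <= n -> forall A : algebra S, V A ->
    forall x y : A, eval3 (t k) x y x = x.
  move=> kn A VA x y; case: (eqs A VA) => A2 _ _ A5.
  case: (posnP k) => [->|k0]; first by rewrite -A2.
  case: (ltngtP k n) kn => [kn _|//|-> _]; last by rewrite A5.
  by rewrite -(A1 _ VA) // k0.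
(* For odd [h], (A4) lets [t h] serve as both terms; for even [h], (A3) joins [t h] to [t h.+1]. *)
case: (boolP (odd h)) => od.
  exists (t h), (t h) => A VA; case: (eqs A VA) => A2 A3 A4 A5; split=> // x y.
    by rewrite idem // ltnW.
  by rewrite A4.
exists (t h), (t h.+1) => A VA; case: (eqs A VA) => A2 A3 A4 A5; split=> // x y.
  by rewrite !idem // ltnW.
by rewrite A3.
Qed.

End Links.

(** * From Gumm terms to alvin terms of the same length *)

Section GummToAlvin.

Variables (S : signature) (V : algebra S -> Prop).

Definition gumm_tail (n : nat) (r : nat -> ternary_term S) : Prop :=
  forall A : algebra S, V A ->
  [/\ forall h, 1 < h <= n -> forall x y : A, eval3 (r h) x y x = x,
      forall h, 1 < h < n -> ~~ odd h ->
        forall x z : A, eval3 (r h) x z z = eval3 (r h.+1) x z z,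
      forall h, 1 < h < n -> odd h ->
        forall x z : A, eval3 (r h) x x z = eval3 (r h.+1) x x z &
      forall x y z : A, eval3 (r n) x y z = z].

(* [r] completes to a sequence of alvin terms as soon as [s(x,x,z) = z]. *)
Definition alvin_upto (n : nat) (s : ternary_term S) : Prop :=
  exists r f, gumm_tail n r /\ forall A : algebra S, V A ->
  [/\ forall x z : A, eval3 f x z z = x,
      forall x y : A, eval3 f x y x = x &
      forall x z : A, eval3 f x x z = eval3 (r 2) x x (eval3 s x x z)].

Variables (n : nat) (t : nat -> ternary_term S).
Hypotheses (n_gt1 : 1 < n) (t_gumm : gumm_terms V n t).

Lemma gumm_tail_of_gumm : gumm_tail n t.
Proof.
case: t_gumm => eqs G1 A VA; case: (eqs A VA) => A2 A3 A4 A5.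
split=> // [h /andP[h1 hn] x y|h /andP[_ hn]|h /andP[_ hn]]; last 2 first.
- exact: A3.
- exact: A4.
case: (ltngtP h n) hn => [hn _|//|-> _]; last by rewrite A5.
by rewrite -(G1 _ VA) // h1.
Qed.

(** In the new tail, the first two arguments of [t_h] agree when [x = y], the last two when [y = z],
    and the outer two are [x] when [z = x]. In the new [f], all arguments of [t_1] become [x] when
    [z = x], so [t_1(x,x,x) = x] suffices. *)
Lemma alvin_upto_step (s d s' : ternary_term S) :
  (forall A : algebra S, V A -> forall x z : A,
     eval3 s x x z = eval3 (bin_comp d s') x x z) ->
  (forall A : algebra S, V A -> forall x : A, eval3 d x x x = x) ->
  link V s s' -> alvin_upto n s -> alvin_upto n s'.
Proof.
move=> sE didem [e [e' eP]] [r [f [tailr fP]]].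
pose d2 a b := comp3 d a a b.
exists (fun h => comp3 (t h) (comp3 (r h) tx (d2 tx ty) (d2 tx tz))
                             (comp3 (r h) tx ty (d2 ty tz)) (r h)).
exists (comp3 (t 1) f (comp3 (r 2) tx tx e) (comp3 (r 2) tx tx e')).
split=> A VA.
- case: (tailr A VA) => ri re ro rn; case: (gumm_tail_of_gumm VA) => ti te to tn.
  split=> [h hn x y|h hn ev x z|h hn od x z|x y z]; rewrite !eval3E.
  + by rewrite didem // !ri // ti.
  + by rewrite didem // -!re // te.
  + by rewrite didem // -!ro // to.
  + by rewrite tn rn.
- case: (fP A VA) => fz fi fx; case: (eP A VA) => ei ef em el.
  case: t_gumm => /(_ A VA)[A2 A3 A4 A5] _.
  case: (tailr A VA) => ri _ _ _.
  split=> x y; rewrite !eval3E.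
  + by rewrite fz em -A3 ?(ltnW n_gt1) // -A2.
  + by rewrite fi (ei x y).1 (ei x y).2 !ri // -A3 ?(ltnW n_gt1) // -A2.
  + by rewrite fx ef el A4 // didem // sE // /bin_comp !eval3E.
Qed.

(** The starting point: take [f = x] and every [r_h = z]. *)
Lemma alvin_upto_proj1 (s : ternary_term S) :
  (forall A : algebra S, V A -> forall x z : A, eval3 s x x z = x) ->
  alvin_upto n s.
Proof.
by move=> sx; exists (fun=> tz), tx; split=> A VA; split=> // x z; rewrite sx.
Qed.

Lemma alvin_upto_tz : alvin_upto n tz -> exists r, alvin_terms V n r.
Proof.
case=> r [f [tailr fP]].
exists (fun h => if h is h'.+1 then if h' is _.+1 then r h else f else tx).
split=> A VA; case: (fP A VA) => fz fi fx; case: (tailr A VA) => ri re ro rn.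
- split; [by []|move=> h hn ev x z|move=> h hn od x z|].
  + case: h hn ev => [|[|h]] hn ev; [by rewrite fz|by []|exact: re].
  + case: h hn od => [|[|h]] hn od; [by []|by rewrite fx|exact: ro].
  + by case: n n_gt1 rn => [|[|m]].
- by case=> [|[|h]] // hn x y; rewrite ri //= ltnW.
Qed.

Lemma alvin_of_gumm k j : alvin_terms V k j -> exists r, alvin_terms V n r.
Proof.
(* Indices are reversed so that [iter_comp eps m] composes [j_(k-m), ..., j_(k-1)]; the factor [j_k]
   acts as the identity. *)
move=> jP; pose eps m := j (k - m).
have [jeqs _] := jP.
have eps0 (A : algebra S) : V A -> forall x z : A, eval3 (eps 0) x x z = z.
  by move=> /jeqs[_ _ _ jk] x z; rewrite /eps subn0.
have epsk (A : algebra S) : V A -> forall x y z : A, eval3 (eps k) x y z = x.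
  by move=> /jeqs[j0 _ _ _] x y z; rewrite /eps subnn -j0.
have linkS m : m < k -> link V (eps m.+1) (eps m).
  move=> mk; rewrite /eps -(subnSK mk).
  by apply: alvin_link jP _; rewrite ltn_subrL (leq_trans _ mk).
have idem m (A : algebra S) : m <= k -> V A -> forall x : A,
    eval3 (eps m) x x x = x.
  case: m => [|m] mk VA x; first exact: eps0.
  have [e [e' /(_ A VA)[ei ef _ _]]] := linkS _ mk.
  by rewrite -ef (ei x x).1.
apply: alvin_upto_tz.
suff H m : m <= k -> alvin_upto n (iter_comp eps (k - m)).
  by have := H k (leqnn k); rewrite subnn.
elim: m => [_|m IH mk].
  apply: alvin_upto_proj1 => A VA x z; rewrite subn0.
  (* If [k = 0], then [j_0] is both projections and [x = z]. *)
  case: (k) (epsk A VA) (eps0 A VA) => [e1 e2|k' e1 _] /=.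
    by rewrite eval3E -[LHS](e2 x) e1.
  by rewrite /bin_comp eval3E e1.
have km : k - m.+1 < k by rewrite ltn_subrL (leq_trans _ mk).
apply: (@alvin_upto_step (iter_comp eps (k - m)) (eps (k - m))).
- by move=> A VA x z; rewrite -(subnSK mk).
- by move=> A VA x; apply: idem => //; apply: leq_subr.
- rewrite -(subnSK mk); exact: link_iter_comp km.
- exact: IH (ltnW mk).
Qed.

End GummToAlvin.

Lemma is_least_exists (P : nat -> Prop) (m : nat) : P m -> exists n, is_least P n.
Proof.
move=> Pm; have exP : exists i, `[< P i >] by exists m; apply/asboolP.
case: (ex_minnP exP) => n /asboolP Pn nP.
by exists n; split=> // i /asboolP; apply: nP.
Qed.

Theorem theorem4 (S : signature) (V : algebra S -> Prop)
    (V_variety : is_variety V) (V_cd : congruence_distributive V) :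
  exists n : nat, alvin_level V n /\ gumm_level V n.
Proof.
have [k [j jP]] := alvin_terms_exist V_variety V_cd.
have [|n [[t tP] nP]] := @is_least_exists (fun m => exists t, gumm_terms V m t) k.
  by exists j; apply: alvin_gumm.
exists n; split; last by split=> //; exists t.
split=> [|m [r /alvin_gumm rP]]; last by apply: nP; exists r.
case: (ltnP 1 n) => n1; first exact: alvin_of_gumm n1 tP _ _ jP.
(* For [n <= 1] no index satisfies [0 < h < n]. *)
exists t; split; first by case: tP.
by move=> A VA h /andP[h0 hn]; have := leq_trans hn n1; rewrite ltnNge h0.
Qed.
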